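(* Let $M\in\mathbb R^{n\times n}$ be a P-matrix, let $b\in\mathbb R^n$, and consider the linear complementarity problem $z\ge0$, $w=Mz-b\ge0$, $z\odot w=0$, with associated data $P=M$, $Q=-I$, $c=b$ (and $y=(z,w)$). Then $$\mu_{\rm L}:=\min_{\Theta\in\mathcal D_{[0,1]}}\sigma_{\min}(I-\Theta+M\Theta)>0.$$ Consequently, for every $\alpha>0$, every $\alpha$-projected stationary point is the unique solution $y^\dagger=(z^\dagger,w^\dagger)$ of the linear complementarity problem. If $\{y^k\}=\{(z^k,w^k)\}$ is generated from some $y^0\in\mathcal C$ by the safeguarded projected-gradient algorithm described in the context and there are constants $\underline\alpha,\overline\alpha$ with $0<\underline\alpha\le\alpha_k\le\overline\alpha<1/L$ for all $k$, then $$(z^k,w^k)\to(z^\dagger,w^\dagger),\qquad \Phi(z^k,w^k)\to0.$$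
   Context: A matrix $M\in\mathbb R^{n\times n}$ is a P-matrix if all its principal minors are positive. Norms are Euclidean (vectors) and spectral (matrices); inequalities are componentwise and $\odot$ is the componentwise product. $\sigma_{\min}(W)$ is the smallest singular value of the square matrix $W$. $\mathcal D_{[0,1]}$ is the set of $n\times n$ diagonal matrices with diagonal entries in $[0,1]$. For data $P,Q\in\mathbb R^{m\times n}$, $c\in\mathbb R^m$, let $\mathcal C:=\{(u,v)\in\mathbb R^n\times\mathbb R^n: u\ge0,\ v\ge0,\ u\odot v=0\}$. For $y=(u,v)\in\mathbb R^{2n}$ set $H:=[P,\ Q]$, $\Phi(y):=\tfrac12\|Hy-c\|^2=\tfrac12\|Pu+Qv-c\|^2$, so $\nabla\Phi(y)=H^\top(Hy-c)$, and $L:=\|H\|^2$. $\Pi_{\mathcal C}(y):=\operatorname{argmin}_{z\in\mathcal C}\|y-z\|$ (possibly set-valued). For $\alpha>0$, a point $y\in\mathcal C$ is $\alpha$-projected stationary if $y\in\Pi_{\mathcal C}(y-\alpha\nabla\Phi(y))$. Safeguarded projected-gradient algorithm. For $y=(u,v)\in\mathcal C$ let $\vartheta_i(y):=\operatorname{sgn}(u_i-v_i)\in\{-1,0,1\}$. Given $y^0\in\mathcal C$, an integer $q\ge1$, $\tau\ge0$, set $\nu_0=0$ and $s_c:=\max\{1,\|c\|\}$. At iteration $k=0,1,2,\dots$: choose a stepsize $\alpha_k>0$; choose $\bar y^{k+1}\in\Pi_{\mathcal C}(y^k-\alpha_k\nabla\Phi(y^k))$; set $\nu_{k+1}:=\nu_k+1$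 if $\vartheta(\bar y^{k+1})=\vartheta(y^k)$ and $\nu_{k+1}:=0$ otherwise. The trigger $\mathcal T_k$ holds if and only if $\|H\bar y^{k+1}-c\|/s_c\le\tau$ or $\nu_{k+1}\ge q$. If $\mathcal T_k$ holds, a refinement candidate $\widehat y^{k+1}$ is computed by some rule (left open; the rule may fail to produce a candidate). If a candidate is produced and $\widehat y^{k+1}\in\mathcal C$ and $\Phi(\widehat y^{k+1})\le\Phi(\bar y^{k+1})$, set $y^{k+1}:=\widehat y^{k+1}$; in all other cases set $y^{k+1}:=\bar y^{k+1}$. *)

(* Defs.v *)
(* MathComp / MathComp-Analysis *)
From HB Require Import structures.
From mathcomp Require Import all_boot all_order all_algebra.
From mathcomp Require Import all_classical all_reals all_analysis.
Set Implicit Arguments.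
Unset Strict Implicit.
Unset Printing Implicit Defensive.
Import Order.TTheory GRing.Theory Num.Theory.
Import numFieldNormedType.Exports.
Local Open Scope classical_set_scope.
Local Open Scope ring_scope.

Section LinearAlgebra.
Variable R : realType.

Definition enorm (n : nat) (x : 'cV[R]_n) : R :=
  Num.sqrt (\sum_(i < n) x i 0 ^+ 2).

Definition nonneg_vec (n : nat) (x : 'cV[R]_n) : Prop := forall i, 0 <= x i 0.

Definition hadamard (n : nat) (x y : 'cV[R]_n) : 'cV[R]_n := map2_mx *%R x y.

(* The square roots of the eigenvalues of A^T A.  For m < n this may add the
   value 0 to the min(m, n) usual singular values, which affects neither the
   largest one nor the square case. *)
Definition singular_values (m n : nat) (A : 'M[R]_(m, n)) : set R :=
  [set Num.sqrt lambda | lambda in [set a | eigenvalue (A^T *m A) a]].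

(* When n > 0 the set of singular values is finite and nonempty, so the
   infimum and the supremum below are a minimum and a maximum. *)
Definition sigma_min (n : nat) (W : 'M[R]_n) : R := inf (singular_values W).

Definition spectral_norm (m n : nat) (A : 'M[R]_(m, n)) : R :=
  sup (singular_values A).

Definition principal_minor (n : nat) (M : 'M[R]_n) (S : {set 'I_n}) : R :=
  \det (mxsub (@enum_val _ (mem S)) (@enum_val _ (mem S)) M).

Definition P_matrix (n : nat) (M : 'M[R]_n) : Prop :=
  forall S : {set 'I_n}, S != finset.set0 -> 0 < principal_minor M S.

Definition diag01 (n : nat) : set 'M[R]_n :=
  [set Theta | is_diag_mx Theta /\ forall i, 0 <= Theta i i <= 1].

Definition is_minimum (S : set R) (x : R) : Prop := S x /\ lbound S x.

Definition lcp_solution (n : nat) (M : 'M[R]_n) (b z w : 'cV[R]_n) : Prop :=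
  [/\ nonneg_vec z, w = M *m z - b, nonneg_vec w & hadamard z w = 0].

End LinearAlgebra.

(* A point y = (u, v) of R^(2n) is a column vector of height n + n, with
   u = usubmx y and v = dsubmx y. *)
Section ComplementarityLeastSquares.
Variables (R : realType) (m n : nat).
Variables (P Q : 'M[R]_(m, n)) (c : 'cV[R]_m).
Implicit Types y z : 'cV[R]_(n + n).

Definition compl_set : set 'cV[R]_(n + n) :=
  [set y | [/\ nonneg_vec (usubmx y), nonneg_vec (dsubmx y)
             & hadamard (usubmx y) (dsubmx y) = 0]].

Definition Hmx : 'M[R]_(m, n + n) := row_mx P Q.

Definition Phi y : R := 2^-1 * enorm (Hmx *m y - c) ^+ 2.

Definition grad_Phi y : 'cV[R]_(n + n) := Hmx^T *m (Hmx *m y - c).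

Definition Lconst : R := spectral_norm Hmx ^+ 2.

Definition proj_compl y : set 'cV[R]_(n + n) :=
  [set z | compl_set z /\
           forall z', compl_set z' -> enorm (y - z) <= enorm (y - z')].

Definition projected_stationary (alpha : R) y : Prop :=
  compl_set y /\ proj_compl (y - alpha *: grad_Phi y) y.

Definition branch_sign y : 'cV[R]_n := map_mx Num.sg (usubmx y - dsubmx y).

Definition residual_scale : R := Num.max 1 (enorm c).

Definition trigger (q : nat) (tau : R) (ybar : 'cV[R]_(n + n)) (nu : nat) :
  Prop :=
  enorm (Hmx *m ybar - c) / residual_scale <= tau \/ (q <= nu)%N.

Definition accepted (q : nat) (tau : R) (ybar : 'cV[R]_(n + n)) (nu : nat)
    (cand : option 'cV[R]_(n + n)) (yhat : 'cV[R]_(n + n)) : Prop :=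
  [/\ trigger q tau ybar nu, cand = Some yhat, compl_set yhat
    & Phi yhat <= Phi ybar].

(* A run of the algorithm.  The sequences ybar and cand are indexed as in
   ybar^(k+1) and yhat^(k+1), so their value at 0 is irrelevant.  The
   refinement rule is left open: cand is an arbitrary sequence, None meaning
   that no candidate is produced; its value at k+1 is consulted only when the
   trigger holds at iteration k. *)
Record safeguarded_pg (q : nat) (tau : R) (alpha : nat -> R)
    (ybar : nat -> 'cV[R]_(n + n)) (nu : nat -> nat)
    (cand : nat -> option 'cV[R]_(n + n)) (y : nat -> 'cV[R]_(n + n)) :
    Prop := SafeguardedPG {
  pg_init : compl_set (y 0%N);
  pg_nu0 : nu 0%N = 0%N;
  pg_step_gt0 : forall k, 0 < alpha k;
  pg_proj : forall k,
    proj_compl (y k - alpha k *: grad_Phi (y k)) (ybar k.+1);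
  pg_nuS : forall k,
    nu k.+1 = if branch_sign (ybar k.+1) == branch_sign (y k)
              then (nu k).+1 else 0%N;
  pg_accept : forall k yhat,
    accepted q tau (ybar k.+1) (nu k.+1) (cand k.+1) yhat -> y k.+1 = yhat;
  pg_reject : forall k,
    ~ (exists yhat,
         accepted q tau (ybar k.+1) (nu k.+1) (cand k.+1) yhat) ->
    y k.+1 = ybar k.+1
}.

End ComplementarityLeastSquares.

Arguments compl_set {R n}.
Arguments proj_compl {R n}.
Arguments diag01 {R n}.

(* Main.v *)
Require Import Defs.
From HB Require Import structures.
From mathcomp Require Import all_boot all_order all_algebra perm ring lra.
From mathcomp Require Import all_classical all_reals all_analysis.
Set Implicit Arguments.
Unset Strict Implicit.
Unset Printing Implicit Defensive.
Import Order.TTheory GRing.Theory Num.Theory.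
Import numFieldNormedType.Exports.
Local Open Scope classical_set_scope.
Local Open Scope ring_scope.

(** Two facts about P-matrices carry everything.

    First, the pencil W(Theta) = I - Theta + M Theta is nonsingular for every
    diagonal Theta with entries in [0, 1].  The i-th row of its transpose is
    theta_i times the i-th row of M^T plus (1 - theta_i) times the i-th unit
    row.  The determinant is linear in each row, so it is a nonnegative
    combination, with weights that do not all vanish, of principal minors
    ([det_P_matrix_rows]).  The smallest singular value of a square matrix is
    the minimum of |W x| on the unit sphere ([sigma_min_attained]), so the
    minimum over Theta is that of the continuous function |W(Theta) x| on the
    product of a cube and a sphere.  Compactness gives a minimum mu, and
    nonsingularity gives mu > 0.  The same mu bounds the transposed pencil
    ([pencil_lower_bounds]).

    Second, the pencil describes the geometry of the complementarity set C on
    both sides.  If y and y' lie in C, then (u - u')_i (v - v')_i <= 0 for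
    every i, so H (y - y') = W(Theta) x with
    x = (u - u') - (v - v') for a suitable Theta; hence
    mu |y - y'| <= |H (y - y')| ([compl_error_bound]).  Dually, at a point of
    C with residual r = H y - b, the gradient (M^T r, - r) lets the i-th pair
    of coordinates decrease the proximal model unless r_i and (M^T r)_i have
    opposite signs, and the total decrease is at least a multiple of
    |W(Theta)^T r|^2 for a suitable Theta ([compl_model_decrease]).

    The second estimate says that some z in C satisfies
    2 alpha <grad Phi(y), z - y> + |z - y|^2 <= - 2 alpha^2 mu^2 Phi(y).
    A projected stationary point minimizes the left-hand side over C with
    value 0, so Phi vanishes there.  A projected gradient step minimizes it
    too, and when alpha L <= 1 this turns into
    Phi(ybar) <= (1 - alpha mu^2) Phi(y).  An accepted refinement has at most
    the value Phi(ybar), so Phi(y^k) tends to 0 geometrically, and the error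
    bound turns this into convergence of y^k.  A minimizer of Phi over C
    exists because the error bound makes Phi coercive on C, and the
    contraction forces Phi = 0 there, which gives the solution of the
    complementarity problem. *)

(** * Determinants of row mixtures of a P-matrix and the identity *)

Section Det.
Variable R : realType.

Lemma det_mxsub_inj m n (f : 'I_m -> 'I_n) (A : 'M[R]_n) :
  m = n -> injective f -> \det (mxsub f f A) = \det A.
Proof.
move=> eq_mn; case: _ / eq_mn in A f * => injf.
have -> : mxsub f f A = row_perm (perm injf) (col_perm (perm injf) A).
  by apply/matrixP=> i j; rewrite !mxE !permE.
rewrite row_permE col_permE !det_mulmx !det_perm mulrCA -signr_addb.
by rewrite odd_permV addbb mulr1.
Qed.

(** A matrix that agrees with M on the rows in S and with the identity on the
    others becomes block triangular once the indices in S are listed first,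
    which relates the minor to a determinant of full size. *)
Lemma principal_minor_padded n (M : 'M[R]_n) (S : {set 'I_n}) :
  \det (\matrix_(i, j) if i \in S then M i j else (i == j)%:R)
  = principal_minor M S.
Proof.
set N := (X in \det X).
pose f (k : 'I_(#|S| + #|~: S|)) : 'I_n :=
  match fintype.split k with inl a => enum_val a | inr b => enum_val b end.
have injf : injective f.
  move=> k l; rewrite /f; case: (splitP k) => a Ha; case: (splitP l) => b Hb e.
  - by apply/val_inj; rewrite /= Ha Hb (enum_val_inj e).
  - by have := enum_valP b; rewrite -e inE enum_valP.
  - by have := enum_valP a; rewrite e inE enum_valP.
  - by apply/val_inj; rewrite /= Ha Hb (enum_val_inj e).
rewrite -(@det_mxsub_inj _ _ f); last exact: injf; last first.
  by rewrite cardsC card_ord.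
have -> : mxsub f f N = block_mx
    (mxsub (@enum_val _ (mem S)) (@enum_val _ (mem S)) M)
    (mxsub (@enum_val _ (mem S)) (@enum_val _ (mem (~: S))) M) 0 1%:M.
  apply/matrixP => k l; rewrite !mxE /f.
  case: (splitP k) => a Ha; rewrite !mxE;
    case: (splitP l) => b Hb; rewrite !mxE.
  - by rewrite enum_valP.
  - by rewrite enum_valP.
  - have := enum_valP a; rewrite inE => /negbTE aS; rewrite aS.
    by case: eqP => // e; move: (enum_valP b); rewrite -e aS.
  - have := enum_valP a; rewrite inE => /negbTE ->.
    by rewrite (inj_eq enum_val_inj).
by rewrite det_ublock det1 mulr1.
Qed.

Lemma P_matrix_tr n (M : 'M[R]_n) : P_matrix M -> P_matrix M^T.
Proof.
by move=> PM S /PM; rewrite /principal_minor -trmx_mxsub det_tr.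
Qed.

(** Splitting a row a_i M_i + d_i e_i by linearity leaves two matrices with
    one mixed row less.  When no mixed row is left, the determinant is a
    principal minor (or 1). *)
Lemma det_P_matrix_rows n (M : 'M[R]_n) (a d : 'I_n -> R) :
  P_matrix M -> (forall i, 0 <= a i) -> (forall i, 0 <= d i) ->
  (forall i, 0 < a i + d i) ->
  0 < \det (\matrix_(i, j) (a i * M i j + d i * (i == j)%:R)).
Proof.
move=> PM.
pose mixed (a d : 'I_n -> R) : {set 'I_n} :=
  [set i | ((a i, d i) != (1, 0)) && ((a i, d i) != (0, 1))]%SET.
have [k] := ubnP #|mixed a d|.
elim: k a d => // k IHk a d lt_k a0 d0 ad.
have [pure|[i mixi]] := set_0Vmem (mixed a d).
  pose S : {set 'I_n} := [set i | (a i, d i) == (1, 0)]%SET.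
  have -> : \matrix_(i, j) (a i * M i j + d i * (i == j)%:R)
          = \matrix_(i, j) if i \in S then M i j else (i == j)%:R.
    apply/matrixP => i j; rewrite !mxE inE.
    have := finset.in_set0 i; rewrite -pure inE.
    case: eqP => [[-> ->] _|_]; first by rewrite mul1r mul0r addr0.
    by move=> /negbFE/eqP[-> ->]; rewrite mul1r mul0r add0r.
  rewrite principal_minor_padded.
  have [->|S0] := eqVneq S finset.set0; last exact: PM.
  rewrite /principal_minor; move: (mxsub _ _ _); rewrite cards0 => B.
  by rewrite det_mx00.
pose upd (f : 'I_n -> R) x j := if j == i then x else f j.
have step x y : 0 <= x -> 0 <= y -> 0 < x + y ->
    ((x, y) == (1, 0)) || ((x, y) == (0, 1)) ->
    0 < \det (\matrix_(k, j) (upd a x k * M k j + upd d y k * (k == j)%:R)).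
  move=> x0 y0 xy pxy; apply: IHk.
  - apply: leq_trans (_ : #|mixed a d| <= k)%N; last by rewrite -ltnS.
    apply: proper_card; apply/properP; split.
      apply/fintype.subsetP => j; rewrite !inE /upd; case: (j == i) => //.
      by rewrite -negb_or pxy.
    by exists i => //; rewrite inE /upd eqxx -negb_or pxy.
  - by move=> j; rewrite /upd; case: (j == i).
  - by move=> j; rewrite /upd; case: (j == i).
  - by move=> j; rewrite /upd; case: (j == i).
set A := (X in \det X).
rewrite (@determinant_multilinear _ _ A
  (\matrix_(k, j) (upd a 1 k * M k j + upd d 0 k * (k == j)%:R))
  (\matrix_(k, j) (upd a 0 k * M k j + upd d 1 k * (k == j)%:R)) i (a i) (d i)).
- have dB := step 1 0 ler01 (lexx _) (ltr_wpDr (lexx _) ltr01)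
    (introT orP (or_introl (eqxx _))).
  have dC := step 0 1 (lexx _) ler01 (ltr_wpDl (lexx _) ltr01)
    (introT orP (or_intror (eqxx _))).
  have [ai|ai] := ltP 0 (a i).
    by apply: ltr_wpDr; [apply: mulr_ge0 => //; exact: ltW|exact: mulr_gt0].
  have di : 0 < d i by apply: lt_le_trans (ad i) _; rewrite gerDr.
  by apply: ltr_wpDl; [apply: mulr_ge0 => //; exact: ltW|exact: mulr_gt0].
- by apply/rowP => j; rewrite !mxE /upd eqxx; ring.
- by apply/matrixP => k' j; rewrite !mxE /upd eq_sym (negbTE (neq_lift _ _)).
- by apply/matrixP => k' j; rewrite !mxE /upd eq_sym (negbTE (neq_lift _ _)).
Qed.

Definition pencil n (M Theta : 'M[R]_n) := 1%:M - Theta + M *m Theta.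

Lemma diag01_pencil_unit n (M Theta : 'M[R]_n) :
  P_matrix M -> diag01 Theta -> pencil M Theta \in unitmx.
Proof.
rewrite /pencil => PM [/is_diag_mxP dT T01]; rewrite unitmxE unitfE -det_tr.
rewrite gt_eqF //.
have -> : (1%:M - Theta + M *m Theta)^T = \matrix_(i, j)
    (Theta i i * M^T i j + (1 - Theta i i) * (i == j)%:R).
  apply/matrixP => i j; rewrite !mxE (bigD1 i) //= big1 => [|l li]; last first.
    by rewrite dT ?mulr0.
  have [->|ij] := eqVneq i j; first by rewrite /=; ring.
  by rewrite dT 1?eq_sym //=; ring.
apply: det_P_matrix_rows => [|i|i|i]; first exact: P_matrix_tr.
- by have /andP[] := T01 i.
- by have /andP[] := T01 i; rewrite subr_ge0.
- by rewrite addrC subrK ltr01.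
Qed.
End Det.

(** * Euclidean inner product and minimization on compact sets *)

Section Euclid.
Variable R : realType.

Definition dotv n (x y : 'cV[R]_n) : R := \sum_i x i 0 * y i 0.

Lemma dotvC n (x y : 'cV[R]_n) : dotv x y = dotv y x.
Proof. by apply: eq_bigr => i _; rewrite mulrC. Qed.

Lemma dotvDl n (x y z : 'cV[R]_n) : dotv (x + y) z = dotv x z + dotv y z.
Proof. by rewrite -big_split; apply: eq_bigr => i _; rewrite mxE mulrDl. Qed.

Lemma dotvZl n a (x y : 'cV[R]_n) : dotv (a *: x) y = a * dotv x y.
Proof.
by rewrite [RHS]big_distrr; apply: eq_bigr => i _; rewrite /= mxE mulrA.
Qed.

Lemma dotvNl n (x y : 'cV[R]_n) : dotv (- x) y = - dotv x y.
Proof. by rewrite -scaleN1r dotvZl mulN1r. Qed.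

Lemma dotvDr n (x y z : 'cV[R]_n) : dotv x (y + z) = dotv x y + dotv x z.
Proof. by rewrite dotvC dotvDl !(dotvC x). Qed.

Lemma dotvZr n a (x y : 'cV[R]_n) : dotv x (a *: y) = a * dotv x y.
Proof. by rewrite dotvC dotvZl dotvC. Qed.

Lemma dotvNr n (x y : 'cV[R]_n) : dotv x (- y) = - dotv x y.
Proof. by rewrite dotvC dotvNl dotvC. Qed.

Definition dotvE := (dotvDl, dotvDr, dotvZl, dotvZr, dotvNl, dotvNr).

Lemma dotvr0 n (x : 'cV[R]_n) : dotv x 0 = 0.
Proof. by rewrite -(scale0r x) dotvZr mul0r. Qed.

Lemma dotv_mulmxl m n (A : 'M[R]_(m, n)) x y :
  dotv (A *m x) y = dotv x (A^T *m y).
Proof.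
transitivity (\sum_i \sum_j A i j * x j 0 * y i 0).
  by apply: eq_bigr => i _; rewrite mxE big_distrl.
rewrite exchange_big; apply: eq_bigr => j _ /=; rewrite mxE big_distrr.
by apply: eq_bigr => i _ /=; rewrite mxE; ring.
Qed.

Lemma dotv_ge0 n (x : 'cV[R]_n) : 0 <= dotv x x.
Proof. by apply: sumr_ge0 => i _; rewrite -expr2 sqr_ge0. Qed.

Lemma dotv_sqr_le n (x : 'cV[R]_n) i : x i 0 ^+ 2 <= dotv x x.
Proof.
rewrite /dotv (bigD1 i) //= -expr2 lerDl.
by apply: sumr_ge0 => j _; rewrite -expr2 sqr_ge0.
Qed.

Lemma dotv_eq0 n (x : 'cV[R]_n) : dotv x x <= 0 -> x = 0.
Proof.
move=> x0; apply/colP => i; rewrite mxE; apply/eqP; rewrite -sqrf_eq0.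
by rewrite eq_le sqr_ge0 (le_trans (dotv_sqr_le x i)).
Qed.

Lemma dotv_gt0 n (x : 'cV[R]_n) : x != 0 -> 0 < dotv x x.
Proof. by rewrite ltNge; apply: contraNN => /dotv_eq0 ->. Qed.

Lemma enorm_sqr n (x : 'cV[R]_n) : enorm x ^+ 2 = dotv x x.
Proof.
rewrite /enorm sqr_sqrtr; first by apply: eq_bigr => i _; rewrite expr2.
by apply: sumr_ge0 => i _; rewrite sqr_ge0.
Qed.

Lemma enorm_le n (x y : 'cV[R]_n) :
  enorm x <= enorm y -> dotv x x <= dotv y y.
Proof.
move=> xy; rewrite -!enorm_sqr lerXn2r ?nnegrE ?sqrtr_ge0 //.
Qed.

Lemma ler_of_sqr (a c : R) : 0 <= c -> a ^+ 2 <= c ^+ 2 -> a <= c.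
Proof.
move=> c0 ac; have [a0|/ltW a0] := leP 0 a; last exact: le_trans a0 c0.
by rewrite -(@ler_pXn2r _ 2) ?nnegrE.
Qed.

Lemma sqr_of_ler (a c : R) : 0 <= a -> a <= c -> a ^+ 2 <= c ^+ 2.
Proof. by move=> a0 ac; rewrite lerXn2r ?nnegrE // (le_trans a0). Qed.

Lemma continuous_sumr (T : topologicalType) (I : finType) (F : I -> T -> R) :
  (forall i, continuous (F i)) -> continuous (fun t => \sum_i F i t).
Proof.
by move=> cF t; apply: cvg_big => [|i _]; [exact: add_continuous | exact: cF].
Qed.

Lemma continuous_mulr (T : topologicalType) (f g : T -> R) :
  continuous f -> continuous g -> continuous (fun t => f t * g t).
Proof. by move=> cf cg t; apply: continuousM; [exact: cf | exact: cg]. Qed.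

Lemma continuous_addr (T : topologicalType) (f g : T -> R) :
  continuous f -> continuous g -> continuous (fun t => f t + g t).
Proof. by move=> cf cg t; apply: cvgD; [exact: cf | exact: cg]. Qed.

Lemma continuous_mulmx (T : topologicalType) m n p
    (F : T -> 'M[R]_(m, n)) (G : T -> 'M[R]_(n, p)) :
  (forall i j, continuous (fun t => F t i j)) ->
  (forall i j, continuous (fun t => G t i j)) ->
  forall i j, continuous (fun t => (F t *m G t) i j).
Proof.
move=> cF cG i j.
rewrite (_ : (fun t => _) = fun t => \sum_k F t i k * G t k j); last first.
  by apply/funext => t; rewrite mxE.
by apply: continuous_sumr => k; exact: continuous_mulr.
Qed.

Lemma continuous_dotv (T : topologicalType) n (F G : T -> 'cV[R]_n) :
  (forall i j, continuous (fun t => F t i j)) ->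
  (forall i j, continuous (fun t => G t i j)) ->
  continuous (fun t => dotv (F t) (G t)).
Proof.
by move=> cF cG; apply: continuous_sumr => k; exact: continuous_mulr.
Qed.

Lemma bounded_closed_min n (K : set 'rV[R]_n) (B : R) (f : 'rV[R]_n -> R) :
  K !=set0 -> closed K -> (forall x, K x -> forall i, `|x 0 i| <= B) ->
  continuous f -> exists2 x, K x & forall y, K y -> f x <= f y.
Proof.
move=> K0 cK KB cf.
have cptK : compact K.
  apply: subclosed_compact cK (@rV_compact _ _ (fun=> `[- B, B]%classic) _) _.
    by move=> _; exact: segment_compact.
  by move=> x /KB xB i /=; rewrite in_itv /= -ler_norml.
have [|x xK xmin] := EVT_min_rV K0 cptK (f := f).
  exact: continuous_subspaceT.
by exists x => [|y yK]; [rewrite -inE | apply: xmin; rewrite inE].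
Qed.

(** Otherwise moving from x0 in the direction - S x0 would make the quadratic
    form negative. *)
Lemma psd_isotropic n (S : 'M[R]_n) (x0 : 'cV[R]_n) :
  S^T = S -> (forall x, 0 <= dotv x (S *m x)) -> dotv x0 (S *m x0) = 0 ->
  S *m x0 = 0.
Proof.
move=> symS psdS iso; set h := S *m x0; apply: dotv_eq0.
have q0 := psdS h; set q := dotv h (S *m h) in q0.
have p0 := dotv_ge0 h; set p := dotv h h in p0 *.
pose t := p / (q + 1).
have := psdS (x0 - t *: h).
rewrite mulmxDr mulmxN -scalemxAr !dotvE iso -/q -/h -/p.
have -> : dotv x0 (S *m h) = p by rewrite -[S]symS -dotv_mulmxl.
have q1 : 0 < q + 1 by rewrite ltr_wpDl.
have tE : t * (q + 1) = p by rewrite /t divfK // gt_eqF.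
have t0 : 0 <= t by rewrite divr_ge0 // ltW.
move=> H; rewrite -tE; suff -> : t = 0 by rewrite mul0r.
move: H; rewrite -tE; nra.
Qed.

(** * Extreme singular values *)

(** The smallest eigenvalue as the minimum of the Rayleigh quotient: at a
    minimizer x0 on the sphere the positive semidefinite matrix S - lambda I
    has x0 as an isotropic vector, hence as a kernel vector.  This is the
    source of all the singular values needed here. *)
Lemma rayleigh_min n (S : 'M[R]_n) : (0 < n)%N -> S^T = S ->
  exists lambda (x0 : 'cV_n), [/\ dotv x0 x0 = 1, S *m x0 = lambda *: x0 &
    forall x, lambda * dotv x x <= dotv x (S *m x)].
Proof.
move=> n0 symS.
pose q (t : 'rV[R]_n) := dotv t^T (S *m t^T).
pose nm (t : 'rV[R]_n) := dotv t^T t^T.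
have cT i j : continuous (fun t : 'rV[R]_n => t^T i j).
  rewrite (_ : (fun t => _) = fun t : 'rV[R]_n => t j i).
    exact: coord_continuous.
  by apply/funext => t; rewrite mxE.
have cq : continuous q.
  apply: continuous_dotv => //; apply: continuous_mulmx => // i j t.
  exact: cst_continuous.
have cnm : continuous nm by exact: continuous_dotv.
have [|||t Kt tmin] := @bounded_closed_min n [set t | nm t = 1] 1 q _ _ _ cq.
- exists (delta_mx 0 (Ordinal n0)).
  rewrite /nm /= /dotv (bigD1 (Ordinal n0)) //=.
  rewrite !mxE !eqxx mul1r big1 ?addr0 // => j /negbTE j0.
  by rewrite !mxE j0 mul0r.
- by apply: (@preimage_closed _ R nm [set x | x = 1]) => [x _|];
    [exact: cnm | exact: closed_eq].
- move=> x /= x1 i; apply: ler_of_sqr => //.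
  rewrite expr1n real_normK ?num_real //.
  by rewrite -x1 /nm; have := dotv_sqr_le x^T i; rewrite mxE.
have lb x : q t * dotv x x <= dotv x (S *m x).
  have [->|x0] := eqVneq x 0; first by rewrite mulmx0 !dotvr0 mulr0.
  have nx := dotv_gt0 x0; set s := Num.sqrt (dotv x x).
  have s2 : s ^+ 2 = dotv x x by rewrite sqr_sqrtr // ltW.
  have s0 : 0 < s by rewrite sqrtr_gt0.
  have := tmin (s^-1 *: x)^T; rewrite /= /nm /q trmxK -scalemxAr !dotvE -s2.
  have s1 : s^-1 * (s^-1 * s ^+ 2) = 1 by field; rewrite gt_eqF.
  move=> /(_ s1); rewrite mulrA -expr2 exprVn ler_pdivlMl ?exprn_gt0 //.
  by rewrite mulrC.
exists (q t), t^T; split => //.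
- apply/eqP; rewrite -subr_eq0 -mul_scalar_mx -mulmxBl; apply/eqP.
  apply: psd_isotropic => [|x|].
  + by rewrite linearB /= symS tr_scalar_mx.
  + by rewrite mulmxBl mul_scalar_mx !dotvE subr_ge0.
  + by rewrite mulmxBl mul_scalar_mx !dotvE (Kt : dotv t^T t^T = 1) mulr1 subrr.
Qed.

Lemma dotv_gram m n (A : 'M[R]_(m, n)) x :
  dotv x ((A^T *m A) *m x) = dotv (A *m x) (A *m x).
Proof. by rewrite dotv_mulmxl mulmxA. Qed.

Lemma gram_sym m n (A : 'M[R]_(m, n)) : (A^T *m A)^T = A^T *m A.
Proof. by rewrite trmx_mul trmxK. Qed.

Lemma singular_values_eigen m n (A : 'M[R]_(m, n)) lambda (x : 'cV_n) :
  dotv x x = 1 -> (A^T *m A) *m x = lambda *: x ->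
  singular_values A (Num.sqrt lambda).
Proof.
move=> x1 Ax; exists lambda => //=; apply/eigenvalueP; exists x^T.
  by rewrite -[A^T *m A]gram_sym -trmx_mul Ax linearZ.
apply/eqP => /(congr1 trmx); rewrite trmxK trmx0 => x0.
by move/eqP: x1; rewrite x0 dotvr0 eq_sym oner_eq0.
Qed.

Lemma singular_valuesE m n (A : 'M[R]_(m, n)) s : singular_values A s ->
  0 <= s /\ exists2 x : 'cV_n, 0 < dotv x x &
    dotv (A *m x) (A *m x) = s ^+ 2 * dotv x x.
Proof.
move=> [a /= /eigenvalueP[v va v0] <-]; split; first exact: sqrtr_ge0.
have v1 : 0 < dotv v^T v^T.
  apply: dotv_gt0; apply: contra_neq v0 => /(congr1 trmx).
  by rewrite trmxK trmx0.
have E : dotv (A *m v^T) (A *m v^T) = a * dotv v^T v^T.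
  by rewrite -dotv_gram -[A^T *m A]gram_sym -trmx_mul va linearZ /= dotvE.
exists v^T => //; rewrite sqr_sqrtr // -(pmulr_lge0 _ v1) -E.
exact: dotv_ge0.
Qed.

Lemma sigma_min_attained n (W : 'M[R]_n) : (0 < n)%N ->
  [/\ 0 <= sigma_min W,
      exists2 x, dotv x x = 1 & dotv (W *m x) (W *m x) = sigma_min W ^+ 2
    & forall x, sigma_min W ^+ 2 * dotv x x <= dotv (W *m x) (W *m x)].
Proof.
move=> n0; have [lambda [x [x1 Sx lb]]] := rayleigh_min n0 (gram_sym W).
have Wx : dotv (W *m x) (W *m x) = lambda.
  by rewrite -dotv_gram Sx dotvE x1 mulr1.
have l0 : 0 <= lambda by rewrite -Wx dotv_ge0.
have mem := singular_values_eigen x1 Sx.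
have low : lbound (singular_values W) (Num.sqrt lambda).
  move=> s /singular_valuesE[s0 [y y0 Ey]].
  rewrite -(@ler_pXn2r _ 2) ?nnegrE ?sqrtr_ge0 // sqr_sqrtr //.
  by rewrite -(ler_pM2r y0) -Ey -dotv_gram.
have -> : sigma_min W = Num.sqrt lambda.
  apply/eqP; rewrite eq_le; apply/andP; split.
    by apply: ge_inf mem; exists (Num.sqrt lambda).
  by apply: lb_le_inf => //; exists (Num.sqrt lambda).
rewrite sqr_sqrtr //; split => [||y]; first exact: sqrtr_ge0.
  by exists x.
by rewrite -dotv_gram.
Qed.

(** The largest eigenvalue of A^T A is minus the smallest one of - A^T A. *)
Lemma spectral_norm_bound m n (A : 'M[R]_(m, n)) x : (0 < n)%N ->
  dotv (A *m x) (A *m x) <= spectral_norm A ^+ 2 * dotv x x.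
Proof.
move=> n0; have symN : (- (A^T *m A))^T = - (A^T *m A).
  by rewrite linearN /= gram_sym.
have [lambda [x0 [x1 Sx lb]]] := rayleigh_min n0 symN.
have {}lb y : dotv (A *m y) (A *m y) <= - lambda * dotv y y.
  by rewrite mulNr lerNr -dotv_gram -dotvNr -mulNmx.
have l0 : 0 <= - lambda.
  by rewrite -[leRHS]mulr1 -x1 (le_trans _ (lb _)) // dotv_ge0.
have mem : singular_values A (Num.sqrt (- lambda)).
  by apply: singular_values_eigen x1 _; rewrite -[LHS]opprK -mulNmx Sx scaleNr.
have up : ubound (singular_values A) (Num.sqrt (- lambda)).
  move=> s /singular_valuesE[s0 [y y0 Ey]].
  rewrite -(@ler_pXn2r _ 2) ?nnegrE ?sqrtr_ge0 // sqr_sqrtr //.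
  by rewrite -(ler_pM2r y0) -Ey.
have le_sup : Num.sqrt (- lambda) <= spectral_norm A.
  by apply: ub_le_sup mem; exists (Num.sqrt (- lambda)).
apply: le_trans (lb x) _; rewrite ler_wpM2r ?dotv_ge0 // -[leLHS]sqr_sqrtr //.
by rewrite lerXn2r ?nnegrE ?sqrtr_ge0 // (le_trans _ le_sup) ?sqrtr_ge0.
Qed.

(** The function |W(Theta) x| is continuous in Theta and x together, and its
    minimum over unit vectors x is the smallest singular value; so a joint
    minimizer has the required Theta. *)
Lemma pencil_sigma_min n (M : 'M[R]_n) : (0 < n)%N ->
  exists2 Theta0, diag01 Theta0 & forall Theta, diag01 Theta ->
    sigma_min (pencil M Theta0) <= sigma_min (pencil M Theta).
Proof.
move=> n0.
(* A row vector of length n + n holds the diagonal of Theta, then x. *)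
pose Th (t : 'rV[R]_(n + n)) := diag_mx (lsubmx t).
pose xx (t : 'rV[R]_(n + n)) := (rsubmx t)^T.
pose f t := dotv (pencil M (Th t) *m xx t) (pencil M (Th t) *m xx t).
have cTh i j : continuous (fun t => Th t i j).
  rewrite (_ : (fun t => _) =
      fun t : 'rV[R]_(n + n) => t 0 (lshift n i) * (i == j)%:R).
    apply: continuous_mulr; first exact: coord_continuous.
    by move=> t; exact: cst_continuous.
  by apply/funext => t; rewrite !mxE mulr_natr.
have cxx i j : continuous (fun t => xx t i j).
  rewrite (_ : (fun t => _) = fun t : 'rV[R]_(n + n) => t j (rshift n i)).
    exact: coord_continuous.
  by apply/funext => t; rewrite !mxE.
have cM i j : continuous (fun t => (M *m Th t) i j).
  by apply: continuous_mulmx => // k l t; exact: cst_continuous.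
have cW i j : continuous (fun t => pencil M (Th t) i j).
  rewrite (_ : (fun t => _) = fun t : 'rV[R]_(n + n) =>
      (i == j)%:R + -1 * Th t i j + (M *m Th t) i j).
    apply: continuous_addr => //; apply: continuous_addr.
      by move=> t; exact: cst_continuous.
    by apply: continuous_mulr => //; move=> t; exact: cst_continuous.
  by apply/funext => t; rewrite !mxE mulN1r.
have cWx : forall i j, continuous (fun t => (pencil M (Th t) *m xx t) i j).
  exact: continuous_mulmx.
have cf : continuous f by exact: continuous_dotv.
pose nm t := dotv (xx t) (xx t).
have cnm : continuous nm by exact: continuous_dotv.
pose box i : set 'rV[R]_(n + n) := (fun t => Th t i i) @^-1` `[0, 1].
have Kmem Theta x : diag01 Theta -> dotv x x = 1 -> exists t,
    [/\ ((\bigcap_(i in setT) box i) `&` nm @^-1` [set x | x = 1]) t,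
        Th t = Theta & xx t = x].
  move=> [dT T01] x1; exists (row_mx (\row_i Theta i i) x^T).
  have ET : Th (row_mx (\row_i Theta i i) x^T) = Theta.
    apply/matrixP => i j; rewrite /Th row_mxKl !mxE.
    have [<-|ij] := eqVneq i j; first by rewrite mulr1n.
    by move/is_diag_mxP: dT => /(_ i j ij) ->.
  have Ex : xx (row_mx (\row_i Theta i i) x^T) = x.
    by rewrite /xx row_mxKr trmxK.
  split => //; split; last by rewrite /= /nm Ex.
  by move=> i _; rewrite /box /= ET in_itv /= T01.
have T1 : @diag01 R n 1%:M.
  by split => [|i]; [exact: scalar_mx_is_diag | rewrite mxE eqxx ler01 lexx].
have [_ [x1 x11 _] _] := sigma_min_attained (1%:M : 'M[R]_n) n0.
have [|||t [Kt nt] tmin] := bounded_closed_min (B := 1) _ _ _ cf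
  (K := (\bigcap_(i in setT) box i) `&` nm @^-1` [set x | x = 1]).
- by have [t [Kt _ _]] := Kmem _ _ T1 x11; exists t.
- apply: closedI.
    apply: closed_bigI => i _; apply: preimage_closed => [t _|].
      exact: cTh.
    exact: interval_closed.
  by apply: preimage_closed => [t _|]; [exact: cnm | exact: closed_eq].
- move=> t [bt nt] i; rewrite -(splitK i) /unsplit; case: fintype.split => j.
    have := bt j I; rewrite /box /= !mxE eqxx mulr1n in_itv /= => /andP[t0 t1].
    by rewrite ger0_norm.
  rewrite -(@ler_pXn2r _ 2) ?nnegrE // expr1n real_normK ?num_real //.
  rewrite -[leRHS]nt; apply: le_trans (dotv_sqr_le _ j).
  by rewrite !mxE.
have DT : diag01 (Th t).
  split; first exact: diag_mx_is_diag.
  by move=> i; have := Kt i I; rewrite /box /= in_itv.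
exists (Th t); first exact: DT.
move=> Theta DTheta.
have [s0 _ slb] := sigma_min_attained (pencil M (Th t)) n0.
have [s0' [x xE fx] _] := sigma_min_attained (pencil M Theta) n0.
have [t' [Kt' ET Ex]] := Kmem _ _ DTheta xE.
apply: (ler_of_sqr s0'); rewrite -fx.
have := tmin _ Kt'; rewrite /f ET Ex; apply: le_trans.
by have := slb (xx t); rewrite [dotv (xx t) (xx t)]nt mulr1.
Qed.
End Euclid.

(** * The lower bound mu and the scalar complementarity estimates *)

Section LCP.
Variable R : realType.

(** A square matrix and its transpose have the same singular values.  Here
    this is read off directly from |W^T y - mu^2 x|^2 >= 0 with W x = y. *)
Lemma unit_tr_lower_bound n (W : 'M[R]_n) (mu : R) : W \in unitmx ->
  (forall x, mu ^+ 2 * dotv x x <= dotv (W *m x) (W *m x)) ->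
  forall y, mu ^+ 2 * dotv y y <= dotv (W^T *m y) (W^T *m y).
Proof.
move=> uW lbW y; set x := invmx W *m y.
have Wx : W *m x = y by rewrite mulKVmx.
have := lbW x; rewrite Wx => lx.
have xy : dotv x (W^T *m y) = dotv y y by rewrite -dotv_mulmxl Wx.
have := dotv_ge0 (W^T *m y - mu ^+ 2 *: x).
rewrite !dotvE (dotvC _ x) xy.
have := dotv_ge0 x; have := sqr_ge0 mu; nra.
Qed.

Lemma pencil_lower_bounds n (M : 'M[R]_n) : (0 < n)%N -> P_matrix M ->
  exists mu : R, [/\ is_minimum
       [set sigma_min (1%:M - Theta + M *m Theta) | Theta in diag01] mu, 0 < mu,
    forall Theta x, diag01 Theta ->
      mu ^+ 2 * dotv x x <= dotv (pencil M Theta *m x) (pencil M Theta *m x) &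
    forall Theta x, diag01 Theta ->
      mu ^+ 2 * dotv x x <=
        dotv ((pencil M Theta)^T *m x) ((pencil M Theta)^T *m x)].
Proof.
move=> n0 PM; have [T0 D0 min0] := pencil_sigma_min M n0.
have [s0 [x x1 fx] _] := sigma_min_attained (pencil M T0) n0.
have mu0 : 0 < sigma_min (pencil M T0).
  rewrite lt_neqAle s0 andbT; apply/eqP => sE.
  have Wx : pencil M T0 *m x = 0; first apply: dotv_eq0.
    by rewrite fx -sE expr0n.
  have xE := mulKmx (diag01_pencil_unit PM D0) x.
  by move/eqP: x1; rewrite -xE Wx mulmx0 dotvr0 eq_sym oner_eq0.
have lb Theta z : diag01 Theta -> sigma_min (pencil M T0) ^+ 2 * dotv z z
    <= dotv (pencil M Theta *m z) (pencil M Theta *m z).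
  move=> DT; have [s1 _ slb] := sigma_min_attained (pencil M Theta) n0.
  exact: le_trans (ler_wpM2r (dotv_ge0 z) (sqr_of_ler s0 (min0 _ DT))) (slb z).
exists (sigma_min (pencil M T0)); split => //.
- by split=> [|s [T DT <-]]; [exists T0 | exact: min0].
- move=> Theta z DT; apply: unit_tr_lower_bound => [|w]; last exact: lb.
  exact: diag01_pencil_unit.
Qed.

(** This picks the entries of Theta: a zero of the segment from a to b. *)
Lemma opposite_signs_average (a b : R) : a * b <= 0 ->
  exists2 t, 0 <= t <= 1 & (1 - t) * a + t * b = 0.
Proof.
move=> ab; have [e|ne] := eqVneq a b.
  have b0 : b = 0.
    move: ab; rewrite e -expr2 => ab.
    by apply/eqP; rewrite -sqrf_eq0 eq_le ab sqr_ge0.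
  by exists 0; [rewrite lexx ler01 | rewrite e b0; ring].
have d0 : a - b != 0 by rewrite subr_eq0.
have dd : 0 < (a - b) ^+ 2 by rewrite exprn_even_gt0.
exists (a / (a - b)); last by field.
have -> : a / (a - b) = a * (a - b) / (a - b) ^+ 2 by field.
have := sqr_ge0 a; have := sqr_ge0 b; move: dd ab.
rewrite !expr2 => dd ab b2 a2.
by rewrite ler_pdivrMr // mul1r divr_ge0 /=; lra.
Qed.

(** One coordinate pair (u, v) of the model decrease, with gradient (g, - p).
    If g and p have opposite signs, t makes the right-hand side vanish and
    nothing has to move.  If both are positive, the right-hand side is
    - alpha^2 min(g, p)^2 for the right endpoint t.  A full step decreases u
    by alpha g when u is large enough to allow it; otherwise switching to the
    v-axis and stepping by alpha p pays for the cost of leaving u.  The case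
    of two negative numbers exchanges the axes. *)
Lemma branch_decrease (alpha g p u v : R) : 0 < alpha ->
  0 <= u -> 0 <= v -> u * v = 0 ->
  exists t u' v', [/\ 0 <= t <= 1, 0 <= u', 0 <= v', u' * v' = 0 &
    2 * alpha * (g * (u' - u) - p * (v' - v)) + (u' - u) ^+ 2 + (v' - v) ^+ 2
    <= - alpha ^+ 2 * ((1 - t) * p + t * g) ^+ 2].
Proof.
move=> a0.
wlog g0 : g p u v / 0 <= g.
  move=> W u0 v0 uv; have [g0|g0] := leP 0 g; first exact: W.
  have [p0|p0] := leP p 0.
    have [||||t [v' [u' [t01 v'0 u'0 uv' H]]]] := W (- p) (- g) v u.
    - by rewrite oppr_ge0.
    - by [].
    - by [].
    - by rewrite mulrC.
    exists (1 - t), u', v'; split => //.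
    + by move: t01; lra.
    + by rewrite mulrC.
    + by move: H; lra.
  have [|t t01 tE] := @opposite_signs_average p g; first by nra.
  by exists t, u, v; split => //; rewrite tE !subrr; lra.
move=> u0 v0 uv.
have [p0|p0] := ltP 0 p; last first.
  have [|t t01 tE] := @opposite_signs_average p g; first by nra.
  by exists t, u, v; split => //; rewrite tE !subrr; lra.
have [t [t01 tg tp]] : exists t, [/\ 0 <= t <= 1,
    ((1 - t) * p + t * g) ^+ 2 <= g ^+ 2 &
    ((1 - t) * p + t * g) ^+ 2 <= p ^+ 2].
  have [gp|pg] := leP g p.
    exists 1; split; rewrite ?ler01 ?lexx //;
      by rewrite subrr mul0r add0r mul1r // lerXn2r ?nnegrE // ltW.
  exists 0; split; rewrite ?ler01 ?lexx //;
    by rewrite subr0 mul0r addr0 mul1r // lerXn2r ?nnegrE // ltW.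
set B := (_ + _) ^+ 2 in tg tp *.
have aB2 : 0 < alpha ^+ 2 by rewrite exprn_gt0.
(* For u <= 2 alpha g the cost of moving u to 0, namely
   u (u - 2 alpha g), is nonpositive. *)
have [ug|ug] := leP u (2 * alpha * g).
  exists t, 0, (v + alpha * p); split => //.
  - by rewrite addr_ge0 // mulr_ge0 // ltW.
  - by rewrite mul0r.
  - have ap : alpha ^+ 2 * B <= alpha ^+ 2 * p ^+ 2 by rewrite ler_pM2l.
    have : u * (u - 2 * alpha * g) <= 0 by rewrite mulr_ge0_le0 // subr_le0.
    by rewrite -/B; move: ap; lra.
have u1 : 0 < u by apply: le_lt_trans ug; rewrite !mulr_ge0 // ltW.
exists t, (u - alpha * g), 0; split => //.
- rewrite subr_ge0; apply: le_trans (ltW ug).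
  by rewrite -mulrA ler_peMl ?ler1n // mulr_ge0 // ltW.
- by rewrite mulr0.
- have v00 : v = 0 by move/eqP: uv; rewrite mulf_eq0 gt_eqF //= => /eqP.
  have ag : alpha ^+ 2 * B <= alpha ^+ 2 * g ^+ 2 by rewrite ler_pM2l.
  by rewrite -/B v00; move: ag; lra.
Qed.
End LCP.

(** * Error bound and model decrease on the complementarity set *)

Section Iteration.
Variables (R : realType) (n : nat) (M : 'M[R]_n) (b : 'cV[R]_n).
Local Notation H := (Hmx M (- 1%:M)).
Local Notation Phi := (Phi M (- 1%:M) b).
Local Notation gradPhi := (grad_Phi M (- 1%:M) b).
Implicit Types y z : 'cV[R]_(n + n).

Lemma dotv_split y z :
  dotv y z = dotv (usubmx y) (usubmx z) + dotv (dsubmx y) (dsubmx z).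
Proof.
rewrite /dotv big_split_ord; congr (_ + _).
  by apply: eq_bigr => i _; rewrite !mxE.
by apply: eq_bigr => i _; rewrite !mxE.
Qed.

Lemma compl_setP y : compl_set y <-> forall i,
  [/\ 0 <= usubmx y i 0, 0 <= dsubmx y i 0 & usubmx y i 0 * dsubmx y i 0 = 0].
Proof.
split=> [[u0 v0 /colP uv] i|yC].
  by split => //; have := uv i; rewrite !mxE.
split=> [i|i|]; [by case: (yC i) | by case: (yC i) | apply/colP => i].
by have [_ _] := yC i; rewrite !mxE.
Qed.

Lemma Hmx_mul y : H *m y = M *m usubmx y - dsubmx y.
Proof. by rewrite -{1}[y]vsubmxK mul_row_col mulNmx mul1mx. Qed.

Lemma diag01_diag (t : 'I_n -> R) : (forall i, 0 <= t i <= 1) ->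
  diag01 (diag_mx (\row_i t i)).
Proof.
by split => [|i]; [exact: diag_mx_is_diag | rewrite !mxE eqxx mulr1n].
Qed.

Lemma PhiE y : Phi y = 2^-1 * dotv (H *m y - b) (H *m y - b).
Proof. by rewrite /Defs.Phi enorm_sqr. Qed.

Lemma Phi_ge0 y : 0 <= Phi y.
Proof. by rewrite PhiE mulr_ge0 ?dotv_ge0 // invr_ge0 ler0n. Qed.

Lemma Phi_expand y d : Phi (y + d) =
  Phi y + dotv (gradPhi y) d + 2^-1 * dotv (H *m d) (H *m d).
Proof.
rewrite !PhiE mulmxDr addrAC.
rewrite [dotv (gradPhi y) d]dotvC /grad_Phi -dotv_mulmxl.
rewrite !dotvE.
rewrite (dotvC b (H *m y)) (dotvC b (H *m d)) (dotvC (H *m y) (H *m d)).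
by field.
Qed.

(** In this section mu is any common lower bound for the pencil and its
    transpose; the minimum of the smallest singular values is one. *)
Variable mu : R.
Hypothesis n_gt0 : (0 < n)%N.
Hypothesis mu_gt0 : 0 < mu.
Hypothesis pencil_lb : forall Theta x, diag01 Theta ->
  mu ^+ 2 * dotv x x <= dotv (pencil M Theta *m x) (pencil M Theta *m x).
Hypothesis pencil_tr_lb : forall Theta x, diag01 Theta ->
  mu ^+ 2 * dotv x x
    <= dotv ((pencil M Theta)^T *m x) ((pencil M Theta)^T *m x).

(** Write (p, q) for the two halves of y - z.  Complementarity makes p_i and
    q_i weakly opposite in sign.  Hence p = Theta x and q = - (I - Theta) x
    for x = p - q and some Theta, which gives H (y - z) = W(Theta) x, and
    |y - z| <= |x|. *)
Lemma compl_error_bound y z : compl_set y -> compl_set z ->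
  mu ^+ 2 * dotv (y - z) (y - z) <= dotv (H *m (y - z)) (H *m (y - z)).
Proof.
move=> /compl_setP yC /compl_setP zC; set d := y - z.
have duv i : usubmx d i 0 * dsubmx d i 0 <= 0.
  have [yu yv yuv] := yC i; have [zu zv zuv] := zC i.
  rewrite /d !linearB /= !mxE in yu yv yuv zu zv zuv *.
  have := mulr_ge0 yu zv; have := mulr_ge0 zu yv; lra.
have /fin_all_exists [t tP] i : exists t, 0 <= t <= 1 /\
    (1 - t) * usubmx d i 0 + t * dsubmx d i 0 = 0.
  by have [t t01 tE] := opposite_signs_average (duv i); exists t.
have DT := diag01_diag (fun i => (tP i).1).
set x := usubmx d - dsubmx d.
have HE : H *m d = pencil M (diag_mx (\row_i t i)) *m x.
  rewrite Hmx_mul /pencil mulmxDl -mulmxA addrC.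
  have -> : diag_mx (\row_i t i) *m x = usubmx d.
    apply/colP => i; rewrite mul_diag_mx !mxE; have := (tP i).2; rewrite !mxE.
    by lra.
  congr (_ + _); apply/colP => i; rewrite mulmxBl mul1mx mul_diag_mx !mxE.
  by have := (tP i).2; rewrite !mxE; lra.
rewrite HE; apply: le_trans (pencil_lb x DT); rewrite ler_wpM2l ?sqr_ge0 //.
rewrite dotv_split /dotv -big_split; apply: ler_sum => i _ /=.
have := duv i; rewrite !mxE; lra.
Qed.

(** The coordinatewise decreases add up to alpha^2 |W(Theta)^T r|^2, where
    Theta collects the parameters chosen in the separate coordinates. *)
Lemma compl_model_decrease alpha y : 0 < alpha -> compl_set y ->
  exists2 z, compl_set z &
    2 * alpha * dotv (gradPhi y) (z - y) + dotv (z - y) (z - y)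
      <= - alpha ^+ 2 * mu ^+ 2 * (2 * Phi y).
Proof.
move=> a0 /compl_setP yC; set r := H *m y - b.
have gE : gradPhi y = col_mx (M^T *m r) (- r).
  by rewrite /grad_Phi tr_row_mx mul_col_mx linearN /= trmx1 mulNmx mul1mx.
have /fin_all_exists [f fP] i : exists f : R * (R * R),
  [/\ 0 <= f.1 <= 1, 0 <= f.2.1, 0 <= f.2.2, f.2.1 * f.2.2 = 0 &
    2 * alpha * ((M^T *m r) i 0 * (f.2.1 - usubmx y i 0)
                 - r i 0 * (f.2.2 - dsubmx y i 0))
    + (f.2.1 - usubmx y i 0) ^+ 2 + (f.2.2 - dsubmx y i 0) ^+ 2
    <= - alpha ^+ 2 * ((1 - f.1) * r i 0 + f.1 * (M^T *m r) i 0) ^+ 2].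
  have [u0 v0 uv] := yC i.
  have [t [u' [v' ?]]] :=
    branch_decrease ((M^T *m r) i 0) (r i 0) a0 u0 v0 uv.
  by exists (t, (u', v')).
pose z := col_mx (\col_i (f i).2.1) (\col_i (f i).2.2).
exists z.
  apply/compl_setP => i; rewrite col_mxKu col_mxKd !mxE.
  by have [_ ? ? ? _] := fP i.
pose Theta : 'M[R]_n := diag_mx (\row_i (f i).1).
have DT : diag01 Theta by apply: diag01_diag => i; case: (fP i).
have := pencil_tr_lb r DT; set w := _ *m r => wlb.
have wE i : w i 0 = (1 - (f i).1) * r i 0 + (f i).1 * (M^T *m r) i 0.
  have -> : w = r - Theta *m r + Theta *m (M^T *m r).
    have -> : w = (1%:M - Theta + Theta *m M^T) *m r.
      rewrite /w; congr (_ *m _); rewrite /pencil linearD /= linearB /= trmx1.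
      by rewrite trmx_mul tr_diag_mx.
    by rewrite mulmxDl mulmxBl mul1mx -mulmxA.
  move: (M^T *m r) => s.
  by rewrite /Theta !mul_diag_mx !mxE; ring.
have r2 : 2 * Phi y = dotv r r by rewrite PhiE -/r; field.
(* The residual is made opaque, so that linearity does not split it below. *)
rewrite r2; clearbody r.
apply: (@le_trans _ _ (- alpha ^+ 2 * dotv w w)); last first.
  by rewrite -mulrA !mulNr lerN2 ler_pM2l // exprn_gt0.
rewrite dotv_split (dotv_split (z - y)) gE.
rewrite !linearB /= !col_mxKu !col_mxKd /dotv !mulr_sumr.
rewrite -!big_split /= mulr_sumr -!big_split /=.
apply: ler_sum => i _; have [_ _ _ _] := fP i; rewrite -wE.
by move: (M^T *m r) => s; rewrite !mxE; lra.
Qed.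

(** * Contraction, stationarity and existence of a solution *)

(** Since Phi is quadratic and |H d|^2 <= L |d|^2, for alpha L <= 1 the
    proximal model at y is an upper bound of 2 alpha (Phi z - Phi y). *)
Lemma Phi_contraction alpha y z : 0 < alpha ->
  alpha * Lconst M (- 1%:M) <= 1 ->
  2 * alpha * dotv (gradPhi y) (z - y) + dotv (z - y) (z - y)
    <= - alpha ^+ 2 * mu ^+ 2 * (2 * Phi y) ->
  Phi z <= (1 - alpha * mu ^+ 2) * Phi y.
Proof.
move=> a0 aL dec.
have := Phi_expand y (z - y); rewrite addrC subrK => ->.
set d := z - y in dec *.
have Hd : alpha * dotv (H *m d) (H *m d) <= dotv d d.
  have nn0 : (0 < n + n)%N by rewrite addn_gt0 n_gt0.
  have := spectral_norm_bound H d nn0; rewrite -/(Lconst M (- 1%:M)) => HL.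
  apply: le_trans (_ : alpha * (Lconst M (- 1%:M) * dotv d d) <= _).
    by rewrite ler_pM2l.
  by rewrite mulrA ler_piMl // dotv_ge0.
rewrite -(ler_pM2l (_ : 0 < 2 * alpha)) ?mulr_gt0 //.
by move: dec Hd; lra.
Qed.

(** Completing the square: the distance to y - alpha grad Phi(y) and the
    proximal model differ by a constant. *)
Lemma proj_model_le alpha y ybar z :
  proj_compl (y - alpha *: gradPhi y) ybar -> compl_set z ->
  2 * alpha * dotv (gradPhi y) (ybar - y) + dotv (ybar - y) (ybar - y)
    <= 2 * alpha * dotv (gradPhi y) (z - y) + dotv (z - y) (z - y).
Proof.
move=> [_ pr] /pr /enorm_le.
have E x : dotv (y - alpha *: gradPhi y - x) (y - alpha *: gradPhi y - x)
    = 2 * alpha * dotv (gradPhi y) (x - y) + dotv (x - y) (x - y)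
      + alpha ^+ 2 * dotv (gradPhi y) (gradPhi y).
  move: (gradPhi y) => g; rewrite !dotvE (dotvC x y) (dotvC y g) (dotvC x g).
  by ring.
by rewrite !E lerD2r.
Qed.

Lemma proj_step_contraction alpha y ybar : 0 < alpha ->
  alpha * Lconst M (- 1%:M) <= 1 -> compl_set y ->
  proj_compl (y - alpha *: gradPhi y) ybar ->
  Phi ybar <= (1 - alpha * mu ^+ 2) * Phi y.
Proof.
move=> a0 aL yC pr; have [z zC dec] := compl_model_decrease a0 yC.
by apply: Phi_contraction => //; apply: le_trans (proj_model_le pr zC) dec.
Qed.

(** At a stationary point the minimum of the model over C is its value 0 at
    y, which contradicts the model decrease unless Phi(y) = 0. *)
Lemma stationary_Phi0 alpha y : 0 < alpha ->
  projected_stationary M (- 1%:M) b alpha y -> Phi y = 0.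
Proof.
move=> a0 [yC pr]; have [z zC dec] := compl_model_decrease a0 yC.
have := le_trans (proj_model_le pr zC) dec.
rewrite subrr !dotvr0 mulr0 addr0.
have am : 0 < alpha ^+ 2 * mu ^+ 2 by rewrite mulr_gt0 ?exprn_gt0.
rewrite -mulrA mulNr mulrA oppr_ge0 pmulr_rle0 // pmulr_rle0 // => P0.
by apply/eqP; rewrite eq_le P0 Phi_ge0.
Qed.

Lemma Phi0_Hmx y : Phi y = 0 -> H *m y = b.
Proof.
rewrite PhiE => /eqP; rewrite mulf_eq0 invr_eq0 pnatr_eq0 /= => /eqP E.
by apply/eqP; rewrite -subr_eq0; apply/eqP/dotv_eq0; rewrite E.
Qed.

(** The positive and negative parts parametrize C by R^n.  In this
    parametrization the error bound makes the sublevel set of Phi at the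
    origin compact. *)
Lemma Phi_minimizer : exists2 y, compl_set y &
  forall z, compl_set z -> Phi y <= Phi z.
Proof.
pose up (t : 'rV[R]_n) : 'cV[R]_n := \col_i (2^-1 * (`|t 0 i| + t 0 i)).
pose um (t : 'rV[R]_n) : 'cV[R]_n := \col_i (2^-1 * (`|t 0 i| - t 0 i)).
pose sp t := col_mx (up t) (um t).
have spC t : compl_set (sp t).
  apply/compl_setP => i; rewrite col_mxKu col_mxKd !mxE.
  have := ler_norm (t 0 i); have := ler_norm (- t 0 i); rewrite normrN => h1 h2.
  have h3 : `|t 0 i| * `|t 0 i| = t 0 i * t 0 i.
    by rewrite -normrM ger0_norm // -expr2 sqr_ge0.
  split; [lra | lra | ].
  have -> : 2^-1 * (`|t 0 i| + t 0 i) * (2^-1 * (`|t 0 i| - t 0 i)) =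
    4^-1 * (`|t 0 i| * `|t 0 i| - t 0 i * t 0 i) by field.
  by rewrite h3 subrr mulr0.
have spK z : compl_set z -> sp (usubmx z - dsubmx z)^T = z.
  move=> /compl_setP zC; rewrite -[RHS]vsubmxK; congr col_mx; apply/colP => i;
    have [u0 v0 /eqP] := zC i; rewrite mulf_eq0 => /orP[]/eqP;
    rewrite !mxE in u0 v0 * => E;
    by rewrite E ?subr0 ?sub0r ?normrN ger0_norm //; field.
have cc i : continuous (fun t : 'rV[R]_n => t 0 i) by exact: coord_continuous.
have cn i : continuous (fun t : 'rV[R]_n => `|t 0 i|).
  by move=> t; apply: continuous_comp; [exact: cc | exact: norm_continuous].
have cst (c : R) : continuous (fun t : 'rV[R]_n => c).
  by move=> t; exact: cst_continuous.
have csp i j : continuous (fun t => sp t i j).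
  rewrite -(splitK i) /unsplit; case: fintype.split => k.
    rewrite (_ : (fun t => _) = fun t : 'rV[R]_n => 2^-1 * (`|t 0 k| + t 0 k)).
      by apply: continuous_mulr => //; exact: continuous_addr.
    by apply/funext => t; rewrite col_mxEu mxE.
  rewrite (_ : (fun t => _) =
      fun t : 'rV[R]_n => 2^-1 * (`|t 0 k| + -1 * t 0 k)).
    apply: continuous_mulr => //; apply: continuous_addr => //.
    exact: continuous_mulr.
  by apply/funext => t; rewrite col_mxEd mxE mulN1r.
have cPhi : continuous (fun t => Phi (sp t)).
  rewrite (_ : (fun t => _) =
      fun t => 2^-1 * dotv (H *m sp t - b) (H *m sp t - b)).
    apply: continuous_mulr => //.
    have cH i j : continuous (fun t => (H *m sp t - b) i j).
      rewrite (_ : (fun t => _) = fun t => (H *m sp t) i j + - b i j).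
        by apply: continuous_addr => //; exact: continuous_mulmx.
      by apply/funext => t; rewrite !mxE.
    exact: continuous_dotv.
  by apply/funext => t; rewrite PhiE.
have zC : compl_set (0 : 'cV[R]_(n + n)).
  by apply/compl_setP => i; rewrite !mxE lexx mulr0.
pose c := 4 * dotv b b / mu ^+ 2.
have m2 : 0 < mu ^+ 2 by rewrite exprn_gt0.
have bnd t : Phi (sp t) <= Phi 0 -> dotv (sp t) (sp t) <= c.
  rewrite !PhiE mulmx0 sub0r ler_pM2l ?invr_gt0 // !dotvE opprK => P0.
  have := compl_error_bound (spC t) zC; rewrite subr0 => err.
  rewrite /c ler_pdivlMr // mulrC; apply: le_trans err _.
  (* Equivalent to |H y|^2 <= 2 |H y - b|^2 + 2 |b|^2. *)
  have := dotv_ge0 (H *m sp t - b *+ 2).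
  move: P0; rewrite mulr2n !dotvE (dotvC b); lra.
(* t^2 <= c implies |t| <= c + 1. *)
have [|||t Kt tmin] := bounded_closed_min (B := c + 1) _ _ _ cPhi
  (K := (fun t => Phi (sp t)) @^-1` [set x | x <= Phi 0]).
- by move: (spK 0 zC); set t := trmx _ => t0; exists t; rewrite /= t0.
- by apply: preimage_closed => [t _|]; [exact: cPhi | exact: closed_le].
- move=> t /bnd; rewrite dotv_split => tc i.
  have := dotv_sqr_le (up t) i; have := dotv_sqr_le (um t) i.
  rewrite col_mxKu col_mxKd in tc => h1 h2.
  have {tc}h : up t i 0 ^+ 2 + um t i 0 ^+ 2 <= c by lra.
  have E : `|t 0 i| ^+ 2 = up t i 0 ^+ 2 + um t i 0 ^+ 2.
    have E : `|t 0 i| ^+ 2 = t 0 i ^+ 2 by rewrite real_normK ?num_real.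
    by rewrite !mxE; lra.
  have := normr_ge0 (t 0 i); move: E h; set a := `|_|; nra.
exists (sp t) => // z zC'.
have [zP|/ltW zP] := leP (Phi z) (Phi 0); last exact: le_trans Kt zP.
by have := tmin (usubmx z - dsubmx z)^T; rewrite /= spK //; apply.
Qed.

(** A step from a minimizer cannot decrease Phi, so the contraction leaves
    only the value 0. *)
Lemma lcp_solvable : exists2 y, compl_set y & H *m y = b.
Proof.
have [y yC ymin] := Phi_minimizer; exists y => //.
have L0 : 0 <= Lconst M (- 1%:M) by rewrite sqr_ge0.
pose alpha := (Lconst M (- 1%:M) + 1)^-1.
have a0 : 0 < alpha by rewrite invr_gt0 ltr_wpDl.
have aL : alpha * Lconst M (- 1%:M) <= 1.
  by rewrite mulrC ler_pdivrMr ?ltr_wpDl // mul1r lerDl.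
have [z zC dec] := compl_model_decrease a0 yC.
have := le_trans (ymin z zC) (Phi_contraction a0 aL dec).
have am : 0 < alpha * mu ^+ 2 by rewrite mulr_gt0 // exprn_gt0.
have P0 := Phi_ge0 y => h.
apply: Phi0_Hmx; apply/eqP; rewrite eq_le P0 andbT -(pmulr_rle0 _ am).
by move: h; lra.
Qed.

Lemma lcp_compl_set (z w : 'cV[R]_n) :
  lcp_solution M b z w <->
  compl_set (col_mx z w) /\ H *m col_mx z w = b.
Proof.
rewrite Hmx_mul col_mxKu col_mxKd /compl_set /= col_mxKu col_mxKd.
split=> [[z0 -> w0 zw]|[[z0 w0 zw] <-]]; last by split; rewrite ?subKr.
by rewrite subKr.
Qed.

Lemma compl_dist_solution y ydag : compl_set y -> compl_set ydag ->
  H *m ydag = b -> dotv (y - ydag) (y - ydag) <= 2 * Phi y / mu ^+ 2.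
Proof.
move=> yC dC dE; rewrite ler_pdivlMr ?exprn_gt0 // mulrC.
apply: le_trans (compl_error_bound yC dC) _.
by rewrite mulmxBr dE PhiE mulrA divff ?mul1r ?pnatr_eq0.
Qed.

Lemma compl_Phi0_unique y ydag : compl_set y -> compl_set ydag ->
  H *m ydag = b -> Phi y = 0 -> y = ydag.
Proof.
move=> yC dC dE P0; apply/eqP; rewrite -subr_eq0; apply/eqP/dotv_eq0.
by apply: le_trans (compl_dist_solution yC dC dE) _; rewrite P0 mulr0 mul0r.
Qed.

(** * Convergence of the safeguarded iteration *)

Section Run.
Variables (q : nat) (tau : R) (alpha : nat -> R).
Variables (ybar : nat -> 'cV[R]_(n + n)) (nu : nat -> nat).
Variables (cand : nat -> option 'cV[R]_(n + n)) (y : nat -> 'cV[R]_(n + n)).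
Hypothesis run : safeguarded_pg M (- 1%:M) b q tau alpha ybar nu cand y.

Lemma safeguard_step k : compl_set (y k.+1) /\ Phi (y k.+1) <= Phi (ybar k.+1).
Proof.
have [acc|rej] := pselect (exists yhat, accepted M (- 1%:M) b q tau
    (ybar k.+1) (nu k.+1) (cand k.+1) yhat).
  by case: acc => yhat acc; rewrite (pg_accept run acc); case: acc.
by rewrite (pg_reject run rej); split=> //; case: (pg_proj run k).
Qed.

Lemma run_compl k : compl_set (y k).
Proof. by case: k => [|k]; [exact: pg_init run | case: (safeguard_step k)]. Qed.

Variables (alpha_lo alpha_hi : R).
Hypothesis lo_gt0 : 0 < alpha_lo.
Hypothesis alpha_bounds : forall k, alpha_lo <= alpha k /\ alpha k <= alpha_hi.
Hypothesis hi_lt : alpha_hi < 1 / Lconst M (- 1%:M).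

Lemma run_geometric : exists2 rho : R, 0 <= rho < 1 &
  forall k, Phi (y k) <= rho ^+ k * Phi (y 0%N).
Proof.
have hi0 : 0 < alpha_hi.
  by have [h1 h2] := alpha_bounds 0; apply: lt_le_trans lo_gt0 (le_trans h1 h2).
have L0 : 0 < Lconst M (- 1%:M).
  by have := lt_trans hi0 hi_lt; rewrite div1r invr_gt0.
(* The maximum with 0 keeps the ratio nonnegative. *)
exists (Num.max 0 (1 - alpha_lo * mu ^+ 2)).
  rewrite le_max lexx /= gt_max ltr01 /= gtrBl.
  by rewrite mulr_gt0 // exprn_gt0.
elim=> [|k IHk]; first by rewrite expr0 mul1r.
have [lo hi] := alpha_bounds k.
have aL : alpha k * Lconst M (- 1%:M) <= 1.
  by rewrite -ler_pdivlMr // (le_trans hi) // ltW.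
have [_ /le_trans] := safeguard_step k; apply.
apply: le_trans (proj_step_contraction (pg_step_gt0 run k) aL (run_compl k)
  (pg_proj run k)) _.
rewrite [_ ^+ k.+1]exprS -mulrA.
apply: le_trans (_ : Num.max 0 (1 - alpha_lo * mu ^+ 2) * Phi (y k) <= _).
  rewrite ler_wpM2r ?Phi_ge0 // le_max; apply/orP; right.
  by rewrite lerD2l lerN2 ler_wpM2r ?sqr_ge0.
by rewrite ler_wpM2l // le_max lexx.
Qed.

Lemma run_Phi_cvg : (Phi (y k) @[k --> \oo] --> (0 : R)).
Proof.
have [rho /andP[rho0 rho1] le_rho] := run_geometric.
apply: (@squeeze_cvgr _ _ _ _ (fun=> 0) (geometric (Phi (y 0%N)) rho)).
- by near=> k; rewrite Phi_ge0 /= mulrC le_rho.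
- exact: cvg_cst.
- by apply: cvg_geometric; rewrite ger0_norm.
Unshelve. all: by end_near. Qed.

Lemma run_cvg ydag : compl_set ydag -> H *m ydag = b -> y @ \oo --> ydag.
Proof.
move=> dC dE; apply/cvg_ballP => e e0.
have c0 : 0 < e ^+ 2 * mu ^+ 2 / 2 by rewrite divr_gt0 // mulr_gt0 ?exprn_gt0.
have /cvgrPdist_lt /(_ _ c0) := run_Phi_cvg.
apply: filterS => k; rewrite sub0r normrN ger0_norm ?Phi_ge0 // => Pk.
split=> // i j; rewrite /ball /= distrC (ord1 j).
rewrite -(@ltr_pXn2r _ 2) ?nnegrE ?(ltW e0) // real_normK ?num_real //.
have := dotv_sqr_le (y k - ydag) i; rewrite !mxE => /le_lt_trans; apply.
apply: le_lt_trans (compl_dist_solution (run_compl k) dC dE) _.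
by rewrite ltr_pdivrMr ?exprn_gt0 // mulrC -ltr_pdivlMr.
Qed.
End Run.
End Iteration.

Theorem corollary3 (R : realType) (n : nat) (M : 'M[R]_n) (b : 'cV[R]_n)
    (n_gt0 : (0 < n)%N) (PM : P_matrix M) :
  (exists mu_L : R,
     is_minimum
       [set sigma_min (1%:M - Theta + M *m Theta) | Theta in diag01] mu_L /\
     0 < mu_L) /\
  (exists zdag wdag : 'cV[R]_n,
    [/\ lcp_solution M b zdag wdag,
        (forall z w : 'cV[R]_n,
           lcp_solution M b z w -> z = zdag /\ w = wdag),
        (forall (alpha : R) (y : 'cV[R]_(n + n)), 0 < alpha ->
           projected_stationary M (- 1%:M) b alpha y ->
           y = col_mx zdag wdag)
      & forall (q : nat) (tau : R) (alpha : nat -> R)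
          (ybar : nat -> 'cV[R]_(n + n)) (nu : nat -> nat)
          (cand : nat -> option 'cV[R]_(n + n)) (y : nat -> 'cV[R]_(n + n))
          (alpha_lo alpha_hi : R),
          (1 <= q)%N -> 0 <= tau ->
          safeguarded_pg M (- 1%:M) b q tau alpha ybar nu cand y ->
          0 < alpha_lo ->
          (forall k, alpha_lo <= alpha k /\ alpha k <= alpha_hi) ->
          alpha_hi < 1 / Lconst M (- 1%:M) ->
          (y @ \oo --> col_mx zdag wdag) /\
          (Phi M (- 1%:M) b (y k) @[k --> \oo] --> (0 : R))]).
Proof.
have [mu [mu_min mu0 lb lbt]] := pencil_lower_bounds n_gt0 PM.
split; first by exists mu.
have [ydag dC dE] := lcp_solvable b n_gt0 mu0 lb lbt.
exists (usubmx ydag), (dsubmx ydag); rewrite vsubmxK; split.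
- by apply/lcp_compl_set; rewrite vsubmxK.
- move=> z w /lcp_compl_set[zwC zwE].
  have -> : ydag = col_mx z w.
    apply: (compl_Phi0_unique mu0 lb dC zwC zwE).
    by rewrite PhiE dE subrr dotvr0 mulr0.
  by rewrite col_mxKu col_mxKd.
- move=> alpha y a0 ystat; have P0 := stationary_Phi0 mu0 lbt a0 ystat.
  by case: ystat => yC _; exact: (compl_Phi0_unique mu0 lb yC dC dE P0).
- move=> q tau alpha ybar nu cand y lo hi _ _ run lo0 bnds hiL; split.
    exact: (run_cvg n_gt0 mu0 lb lbt run lo0 bnds hiL dC dE).
  exact: (run_Phi_cvg n_gt0 mu0 lbt run lo0 bnds hiL).
Qed.
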